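(* Let $A \in \mathbb{R}^{m\times n}$ ($m\ge n$) have full column rank with reduced QR decomposition $A = QR$, $Q^TQ = I_n$, and let $\bm q_i\in\mathbb{R}^{1\times n}$ denote the $i$-th row of $Q$. Define $\theta(Q) := \max_{1\le i\le m}\|\bm q_i\|_2^2$. Let $l \ge n$ and form $A_1 \in \mathbb{R}^{l\times n}$ by choosing indices $i_1,\dots,i_l \in \{1,\dots,m\}$ independently and uniformly at random (each with probability $1/m$, with replacement) and letting the $s$-th row of $A_1$ be the $i_s$-th row of $A$. When $A_1$ has full column rank let $R_1$ be the upper triangular factor (positive diagonal) of a reduced QR decomposition of $A_1$ and $X := AR_1^{-1}$; when $A_1$ is rank deficient set $\operatorname{cond}(X) := +\infty$. Then for every $\delta > 0$ and $\varepsilon \in (0,1)$, $$\mathbb{P}\left[\operatorname{cond}(X) \ge \sqrt{\frac{1+\delta}{1-\varepsilon}}\right] \le n\left[\left(\frac{e^{-\varepsilon}}{(1-\varepsilon)^{1-\varepsilon}}\right)^{l/(m\theta(Q))} + \left(\frac{e^{\delta}}{(1+\delta)^{1+\delta}}\right)^{l/(m\theta(Q))}\right].$$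
   Context: For a full column rank matrix $M$, $\operatorname{cond}(M) = \sigma_{\max}(M)/\sigma_{\min}(M)$, the ratio of its largest and smallest (i.e. $n$-th) singular values. *)

(* Defs.v *)
From HB Require Import structures.
From mathcomp Require Import all_boot all_order all_algebra.
From mathcomp Require Import boolp classical_sets reals.
From mathcomp.analysis Require Import sequences exp.
Set Implicit Arguments. Unset Strict Implicit. Unset Printing Implicit Defensive.
Import Order.TTheory GRing.Theory Num.Theory.
Local Open Scope ring_scope.

Section Defs.
Variable R : realType.

Definition upper_tri n (M : 'M[R]_n) : Prop :=
  forall i j : 'I_n, (j < i)%N -> M i j = 0.

Definition reduced_QR p n (M : 'M[R]_(p, n)) (Q : 'M[R]_(p, n)) (Rf : 'M[R]_n)
  : Prop :=
  [/\ M = Q *m Rf, Q^T *m Q = 1%:M, upper_tri Rf & forall i, 0 < Rf i i].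

Definition sigma_max p n (M : 'M[R]_(p, n)) : R :=
  sup [set Num.sqrt a | a in [set a : R | eigenvalue (M^T *m M) a]].
Definition sigma_min p n (M : 'M[R]_(p, n)) : R :=
  inf [set Num.sqrt a | a in [set a : R | eigenvalue (M^T *m M) a]].

Definition cond p n (M : 'M[R]_(p, n)) : R := sigma_max M / sigma_min M.

Definition theta m n (Q : 'M[R]_(m, n)) : R :=
  \big[Num.max/0]_(i < m) \sum_(j < n) Q i j ^+ 2.

Definition sample_rows m n l (A : 'M[R]_(m, n)) (f : {ffun 'I_l -> 'I_m})
  : 'M[R]_(l, n) := \matrix_(s < l, j < n) A (f s) j.

(* the event  cond(X) >= t, with cond(X) = +oo when A_1 is rank deficient,
   X = A R_1^{-1}, R_1 the R-factor of a reduced QR decomposition of A_1 *)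
Definition cond_event m n l (A : 'M[R]_(m, n)) (t : R)
  (f : {ffun 'I_l -> 'I_m}) : Prop :=
  let A1 := sample_rows A f in
  (\rank A1 < n)%N \/
  exists (Q1 : 'M[R]_(l, n)) (R1 : 'M[R]_n),
    reduced_QR A1 Q1 R1 /\ t <= cond (A *m invmx R1).

(* probability under i_1..i_l i.i.d. uniform on {1..m}: the uniform
   distribution on the m^l functions 'I_l -> 'I_m *)
Definition prob_unif m l (E : {ffun 'I_l -> 'I_m} -> Prop) : R :=
  (#|[set f : {ffun 'I_l -> 'I_m} | `[< E f >]]|)%:R / (m ^ l)%:R.

End Defs.

(* Main.v *)
(* Write S for the sum of the rank-one matrices q_{i_s}^T q_{i_s}. The Gram
   matrix of X has the inverses of the eigenvalues of S as eigenvalues, so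
   cond(X) can only be large if S has an eigenvalue above (1 + delta) l / m or
   below (1 - eps) l / m. Both tails are matrix Chernoff bounds with the
   potential tr (1 +- t S)^N, t = theta / N, in place of tr exp (+- theta S),
   which avoids the Golden-Thompson and Lieb inequalities. If B = M + t q^T q
   with M positive semidefinite, the moments q M^j q^T are log-convex, which
   controls the mixed moments q B^k M^j q^T and hence tr B^N - tr M^N; averaging
   over the rows uses sum_i q_i^T q_i = 1, and iterating over the l samples and
   letting N tend to infinity gives the scalar bound. *)
Require Import Defs.
From HB Require Import structures.
From mathcomp Require Import all_boot all_order all_algebra.
From mathcomp Require Import boolp classical_sets reals.
From mathcomp.analysis Require Import sequences exp.
From mathcomp Require Import ring lra.
Set Implicit Arguments.
Unset Strict Implicit.
Unset Printing Implicit Defensive.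
Import Order.TTheory GRing.Theory Num.Theory.
Local Open Scope ring_scope.

(** * Log-convex sequences and mixed moments *)

Section LogConvex.
Variables (R : realFieldType) (m : nat -> R).
Hypotheses (m_ge0 : forall j, 0 <= m j)
  (m_logconvex : forall j, m j.+1 ^+ 2 <= m j * m j.+2).

(** Log-convexity makes the ratios of consecutive terms nondecreasing. The induction on [d] avoids
    dividing: it multiplies through by [m k.+1], and the bound is trivial when that term
    vanishes. *)
Lemma logconvex_spread d i : m i.+1 * m (i + d)%N <= m i * m (i + d).+1.
Proof.
elim: d i => [|d IHd] i; first by rewrite addn0 mulrC.
rewrite addnS; set k := (i + d)%N.
have [mk0|mk_neq0] := eqVneq (m k.+1) 0.
  by rewrite mk0 mulr0 mulr_ge0.
have mk_gt0 : 0 < m k.+1 by rewrite lt_def mk_neq0 m_ge0.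
rewrite -(ler_pM2r mk_gt0) -mulrA -expr2.
apply: (le_trans (ler_wpM2l (m_ge0 _) (m_logconvex k))).
rewrite mulrA [leRHS]mulrAC.
exact: ler_wpM2r (m_ge0 _) _ _ (IHd i).
Qed.

(** Units are moved one at a time from the smaller index to the larger one, until the smaller is
    0. *)
Lemma logconvex_submul i j : m i * m j <= m 0%N * m (i + j)%N.
Proof.
wlog le_ij : i j / (i <= j)%N.
  move=> H; have [/H//|/ltnW/H] := leqP i j.
  by rewrite mulrC addnC.
elim: i j le_ij => [|i IHi] j le_ij; first by rewrite add0n.
have /le_trans : m i.+1 * m j <= m i * m j.+1.
  by rewrite -[j](subnKC (ltnW le_ij)); exact: logconvex_spread.
apply; rewrite addSnnS; apply: IHi.
exact: leqW (ltnW le_ij).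
Qed.

End LogConvex.

(* With m_j = q M^j q^T and B = M + t q^T q, mixed_moment m t k j is
   q B^k M^j q^T: the recursion comes from B^(k+1) = B^k (M + t q^T q). *)
Fixpoint mixed_moment (R : realFieldType) (m : nat -> R) (t : R)
  (k j : nat) : R :=
  if k is k'.+1
  then mixed_moment m t k' j.+1 + t * mixed_moment m t k' 0%N * m j
  else m j.

Section MixedMoment.
Variables (R : realFieldType) (m : nat -> R) (t mu L : R).
Hypotheses (m_ge0 : forall j, 0 <= m j)
  (m_submul : forall i j, m i * m j <= m 0%N * m (i + j)%N)
  (t_ge0 : 0 <= t) (mu_gt0 : 0 < mu) (L_ge0 : 0 <= L) (m0_le : m 0%N <= L)
  (m_growth : forall j, mu * m j <= m j.+1).
Local Notation b := (mixed_moment m t).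

Lemma mixed_moment_ge0 k j : 0 <= b k j.
Proof.
elim: k j => [|k IHk] j //=.
by rewrite addr_ge0 // !mulr_ge0.
Qed.

Lemma mixed_moment_submul k i j : b k j * m i <= m 0%N * b k (i + j)%N.
Proof.
elim: k i j => [|k IHk] i j /=; first by rewrite mulrC.
rewrite mulrDl mulrDr -addnS lerD //.
rewrite -mulrA [leRHS]mulrCA ler_wpM2l ?mulr_ge0 ?mixed_moment_ge0 //.
by rewrite mulrC.
Qed.

Lemma mixed_moment_growth k j : mu * b k j <= b k j.+1.
Proof.
elim: k j => [|k IHk] j //=.
rewrite mulrDr lerD // mulrCA ler_wpM2l //.
by rewrite mulr_ge0 ?mixed_moment_ge0.
Qed.

Lemma mixed_moment_shift k j : b k j.+1 <= b k.+1 j.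
Proof. by rewrite /= lerDl !mulr_ge0 ?mixed_moment_ge0. Qed.

(** The cost of replacing one factor B by M: submultiplicativity merges the product in the recursion
    into a single mixed moment, at the price [m 0 <= L]. *)
Lemma mixed_moment_step k j : b k.+1 j <= b k j.+1 + t * L * b k j.
Proof.
rewrite /= lerD2l -!mulrA ler_wpM2l //.
apply: le_trans (mixed_moment_submul k j 0) _.
by rewrite addn0 ler_wpM2r ?mixed_moment_ge0.
Qed.

(** The growth condition absorbs the error of each replacement of B by M into a factor 1 + t L / mu;
    there are k replacements. *)
Lemma mixed_moment_upper k j :
  b k j <= (1 + t * L / mu) ^+ k * m (k + j)%N.
Proof.
have c_ge0 : 0 <= 1 + t * L / mu.
  by rewrite addr_ge0 ?mulr_ge0 ?invr_ge0 // ltW.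
elim: k j => [|k IHk] j; first by rewrite expr0 mul1r.
apply: le_trans (mixed_moment_step k j) _.
apply: (@le_trans _ _ ((1 + t * L / mu) * b k j.+1)).
  rewrite mulrDl mul1r lerD2l -!mulrA ler_wpM2l // ler_wpM2l //.
  by rewrite ler_pdivlMl // mixed_moment_growth.
by rewrite exprS -[leRHS]mulrA ler_wpM2l // addSnnS.
Qed.

(** Here each M is turned back into B. The error [b k j] is at most [b k.+1 j / mu], so each of the
    j exchanges costs a factor 1 - t L / mu, nonnegative by the assumption on t. *)
Lemma mixed_moment_lower k j : t * L <= mu ->
  (1 - t * L / mu) ^+ j * b (k + j)%N 0%N <= b k j.
Proof.
move=> tL_le; have rho_ge0 : 0 <= 1 - t * L / mu.
  by rewrite subr_ge0 ler_pdivrMr // mul1r.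
elim: j k => [|j IHj] k; first by rewrite expr0 mul1r addn0.
rewrite exprS -[leLHS]mulrA -addSnnS.
apply: le_trans (ler_wpM2l rho_ge0 (IHj k.+1)) _.
rewrite mulrBl mul1r lerBlDr.
apply: le_trans (mixed_moment_step k j) _.
rewrite lerD2l -!mulrA ler_wpM2l // ler_wpM2l //.
rewrite ler_pdivlMl //.
exact: le_trans (mixed_moment_growth k j) (mixed_moment_shift k j).
Qed.

End MixedMoment.

(** * Positive semidefinite forms, their moments and traces of powers *)

Section QuadraticForms.
Variables (R : realFieldType) (n : nat).
Implicit Types (M B : 'M[R]_n) (x y q v : 'rV[R]_n).

Definition bform M x y : R := (x *m M *m y^T) 0 0.

Lemma bformDl M x x' y : bform M (x + x') y = bform M x y + bform M x' y.
Proof. by rewrite /bform !mulmxDl mxE. Qed.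
Lemma bformDr M x y y' : bform M x (y + y') = bform M x y + bform M x y'.
Proof. by rewrite /bform linearD mulmxDr mxE. Qed.
Lemma bformZl M a x y : bform M (a *: x) y = a * bform M x y.
Proof. by rewrite /bform -!scalemxAl mxE. Qed.
Lemma bformZr M a x y : bform M x (a *: y) = a * bform M x y.
Proof. by rewrite /bform linearZ -scalemxAr mxE. Qed.
Lemma bform_addM M B x y : bform (M + B) x y = bform M x y + bform B x y.
Proof. by rewrite /bform mulmxDr mulmxDl mxE. Qed.
Lemma bform_oppM M x y : bform (- M) x y = - bform M x y.
Proof. by rewrite /bform mulmxN mulNmx mxE. Qed.
Lemma bform_scaleM a M x y : bform (a *: M) x y = a * bform M x y.
Proof. by rewrite /bform -scalemxAr -scalemxAl mxE. Qed.
Lemma bform_sym M x y : M^T = M -> bform M x y = bform M y x.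
Proof.
move=> Msym; rewrite /bform.
have -> : x *m M *m y^T = (y *m M *m x^T)^T.
  by rewrite !trmx_mul Msym trmxK mulmxA.
by rewrite mxE.
Qed.
Lemma bform_mulml M B x y : bform (M *m B) x y = bform B (x *m M) y.
Proof. by rewrite /bform !mulmxA. Qed.
Lemma bform_mulmr M B x y : bform (M *m B) x y = bform M x (y *m B^T).
Proof. by rewrite /bform trmx_mul trmxK !mulmxA. Qed.
Lemma bform1E x y : bform 1%:M x y = \sum_j x 0 j * y 0 j.
Proof. by rewrite /bform mulmx1 mxE; apply: eq_bigr => j _; rewrite mxE. Qed.
Lemma bform_delta M i : bform M (delta_mx 0 i) (delta_mx 0 i) = M i i.
Proof. by rewrite /bform -rowE trmx_delta -colE !mxE. Qed.
Lemma mxtrace_bform M : \tr M = \sum_i bform M (delta_mx 0 i) (delta_mx 0 i).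
Proof. by apply: eq_bigr => i _; rewrite bform_delta. Qed.

Definition psd M : Prop := M^T = M /\ forall x, 0 <= bform M x x.

Lemma bform1_ge0 x : 0 <= bform 1%:M x x.
Proof. by rewrite bform1E sumr_ge0 // => j _; rewrite -expr2 sqr_ge0. Qed.

Lemma bform1_eq0 x : (bform 1%:M x x == 0) = (x == 0).
Proof.
apply/eqP/eqP => [|->]; last by rewrite /bform !mul0mx mxE.
rewrite bform1E => /eqP; rewrite psumr_eq0; last first.
  by move=> j _; rewrite -expr2 sqr_ge0.
move=> /allP x0; apply/rowP => j; rewrite mxE; apply/eqP.
by have := x0 j (mem_index_enum _); rewrite mulf_eq0 orbb.
Qed.

Lemma bform1_gt0 x : x != 0 -> 0 < bform 1%:M x x.
Proof. by move=> x0; rewrite lt_def bform1_eq0 x0 bform1_ge0. Qed.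

Lemma psd1 : psd 1%:M.
Proof. by split; [rewrite trmx1|exact: bform1_ge0]. Qed.
Lemma psdD M B : psd M -> psd B -> psd (M + B).
Proof.
move=> [Ms M0] [Bs B0]; split; first by rewrite linearD /= Ms Bs.
by move=> x; rewrite bform_addM addr_ge0.
Qed.
Lemma psdZ a M : 0 <= a -> psd M -> psd (a *: M).
Proof.
move=> a0 [Ms M0]; split; first by rewrite linearZ /= Ms.
by move=> x; rewrite bform_scaleM mulr_ge0.
Qed.
Lemma psd0 : psd 0.
Proof. by rewrite -(scale0r 1%:M); exact: psdZ psd1. Qed.
Lemma psd_congr M B : M^T = M -> psd B -> psd (M *m B *m M).
Proof.
move=> Ms [Bs B0]; split; first by rewrite !trmx_mul Ms Bs mulmxA.
by move=> x; rewrite bform_mulmr bform_mulml Ms.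
Qed.

Lemma psd_cauchy M x y : psd M ->
  bform M x y ^+ 2 <= bform M x x * bform M y y.
Proof.
move=> [Ms M0].
have E a b : bform M (a *: x + b *: y) (a *: x + b *: y) =
   a ^+ 2 * bform M x x + 2 * a * b * bform M x y + b ^+ 2 * bform M y y.
  rewrite bformDl !bformDr !bformZl !bformZr (bform_sym y x Ms).
  ring.
have [y0|y_neq0] := eqVneq (bform M y y) 0.
  suff -> : bform M x y = 0 by rewrite y0 mulr0 expr0n.
  apply/eqP; apply: contraT => b0.
  (* When y is isotropic the form is affine in the coefficient of y; this coefficient gives it the
     value -1. *)
  have := M0 (1 *: x + (- (bform M x x + 1) / (2 * bform M x y)) *: y).
  rewrite E y0; set a := bform M x x; set b := bform M x y.
  have -> : 1 ^+ 2 * a + 2 * 1 * (- (a + 1) / (2 * b)) * b +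
    (- (a + 1) / (2 * b)) ^+ 2 * 0 = -1 by field.
  lra.
have y_gt0 : 0 < bform M y y by rewrite lt_def y_neq0 M0.
rewrite -subr_ge0 -(pmulr_rge0 _ y_gt0).
have := M0 (bform M y y *: x + (- bform M x y) *: y); rewrite E.
by congr (0 <= _); ring.
Qed.

Lemma sym_exp M k : M^T = M -> (M ^+ k)^T = M ^+ k.
Proof.
move=> Ms; elim: k => [|k IHk]; first by rewrite expr0 -idmxE trmx1.
by rewrite exprS -mulmxE trmx_mul Ms IHk !mulmxE -exprSr -exprS.
Qed.

(** Congruence by M raises the exponent by two, so the induction carries two consecutive powers; no
    square root or diagonalisation is involved. *)
Lemma psd_exp M k : psd M -> psd (M ^+ k).
Proof.
move=> Mpsd; have [Ms _] := Mpsd.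
suff [] : psd (M ^+ k) /\ psd (M ^+ k.+1) by [].
elim: k => [|k [IH1 IH2]].
  by rewrite expr0 -idmxE expr1; split=> //; exact: psd1.
by split=> //; rewrite exprSr exprS -mulmxE; exact: psd_congr.
Qed.

Definition moment M q j := bform (M ^+ j) q q.

Lemma moment_ge0 M q j : psd M -> 0 <= moment M q j.
Proof. by move=> Mpsd; have [_ ->] := psd_exp j Mpsd. Qed.

(** Cauchy-Schwarz for the form of M^j, applied to q and q M. *)
Lemma moment_logconvex M q j : psd M ->
  moment M q j.+1 ^+ 2 <= moment M q j * moment M q j.+2.
Proof.
move=> Mpsd; have [Ms _] := Mpsd; have Mj := psd_exp j Mpsd.
have := psd_cauchy q (q *m M) Mj.
have -> : bform (M ^+ j) q (q *m M) = moment M q j.+1.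
  by rewrite /moment exprSr -mulmxE bform_mulmr Ms.
suff -> : bform (M ^+ j) (q *m M) (q *m M) = moment M q j.+2 by [].
by rewrite /moment exprSr exprS -mulmxE bform_mulmr Ms bform_mulml.
Qed.

Lemma moment_submul M q i j : psd M ->
  moment M q i * moment M q j <= moment M q 0 * moment M q (i + j).
Proof.
move=> Mpsd; apply: logconvex_submul => k.
  exact: moment_ge0.
exact: moment_logconvex.
Qed.

Lemma psd_subr_scalar M mu q : psd (M - mu%:M) ->
  mu * bform 1%:M q q <= bform M q q.
Proof.
case=> _ /(_ q); rewrite bform_addM bform_oppM -[mu%:M]scalemx1 bform_scaleM.
by rewrite subr_ge0.
Qed.

(** The first ratio m_1 / m_0 is at least mu, and submultiplicativity with index 1 passes this on to
    every later ratio. *)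
Lemma moment_growth M mu q j : 0 <= mu -> psd M -> psd (M - mu%:M) ->
  mu * moment M q j <= moment M q j.+1.
Proof.
move=> mu0 Mpsd Mmu.
have [q0|q0] := eqVneq q 0.
  by rewrite q0 /moment /bform !mul0mx mxE mulr0.
rewrite -(ler_pM2l (bform1_gt0 q0)).
have := moment_submul q 1 j Mpsd.
rewrite /moment expr0 expr1 -idmxE add1n; apply: le_trans.
rewrite mulrCA mulrA ler_wpM2r ?(moment_ge0 _ _ Mpsd) //.
exact: psd_subr_scalar.
Qed.

(** The difference M^j (1 - M) is a congruence by M^(j/2) of 1 - M for even j, and of M (1 - M) for
    odd j. *)
Lemma moment_decay M q j : psd M -> psd (1%:M - M) ->
  moment M q j.+1 <= moment M q j.
Proof.
move=> Mpsd M1; have [Ms _] := Mpsd.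
suff [_ /(_ q)] : psd (M ^+ j - M ^+ j.+1).
  by rewrite bform_addM bform_oppM subr_ge0.
have K k : psd (M ^+ k *m (1%:M - M) *m M ^+ k).
  by apply: psd_congr => //; exact: sym_exp.
have P2 : psd (M *m (1%:M - M)).
  (* Multiplying by 1 = M + (1 - M) splits this product of commuting matrices into two
     congruences. *)
  have -> : M *m (1%:M - M) =
      M *m (1%:M - M) *m M + (1%:M - M) *m M *m (1%:M - M).
    have -> : (1%:M - M) *m M = M *m (1%:M - M).
      by rewrite mulmxBr mulmxBl mulmx1 mul1mx.
    by rewrite -mulmxDr [M + _]addrC subrK mulmx1.
  apply: psdD; apply: psd_congr => //; by case: M1.
have Pk k : psd (M ^+ k *m (M *m (1%:M - M)) *m M ^+ k).
  by apply: psd_congr => //; exact: sym_exp.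
have C a b : M ^+ a *m (1%:M - M) *m M ^+ b = M ^+ (a + b) *m (1%:M - M).
  rewrite !mulmxBr !mulmxBl !mulmx1 !mulmxE -!exprSr -!exprD.
  by rewrite addSn.
have -> : M ^+ j - M ^+ j.+1 = M ^+ j *m (1%:M - M).
  by rewrite mulmxBr mulmx1 mulmxE -exprSr.
rewrite -(odd_double_half j) -addnn; case: (odd j) => /=.
  have := Pk j./2; rewrite mulmxA mulmxE -exprSr -mulmxE C.
  by rewrite addSn add1n.
by rewrite add0n -C; exact: K.
Qed.

Lemma mxtrace_growth M j : psd M -> psd (M - 1%:M) ->
  \tr (M ^+ j) <= \tr (M ^+ j.+1).
Proof.
move=> M0 M1; rewrite !mxtrace_bform ler_sum // => i _.
have := moment_growth (delta_mx 0 i) j ler01 M0 M1.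
by rewrite mul1r.
Qed.

Lemma mxtrace_decay M j : psd M -> psd (1%:M - M) ->
  \tr (M ^+ j.+1) <= \tr (M ^+ j).
Proof.
by move=> M0 M1; rewrite !mxtrace_bform ler_sum // => i _; exact: moment_decay.
Qed.

Lemma mxtrace_psd_exp_ge0 M j : psd M -> 0 <= \tr (M ^+ j).
Proof.
by move=> M0; rewrite mxtrace_bform sumr_ge0 // => i _; exact: moment_ge0.
Qed.

(* Cauchy-Schwarz on the columns of M^k bounds its Frobenius norm below by
   the norm of the eigenvector's image. *)
Lemma mxtrace_exp_eigen M v a k : M^T = M -> v != 0 -> v *m M = a *: v ->
  a ^+ k.*2 <= \tr (M ^+ k.*2).
Proof.
move=> Ms v0 vM.
have vMk : v *m M ^+ k = a ^+ k *: v.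
  elim: k => [|k IHk]; first by rewrite !expr0 -idmxE mulmx1 scale1r.
  by rewrite exprSr -mulmxE mulmxA IHk -scalemxAl vM scalerA -exprSr.
set B := M ^+ k; have Bs : B^T = B by exact: sym_exp.
rewrite -(ler_pM2r (bform1_gt0 v0)).
have -> : a ^+ k.*2 * bform 1%:M v v = bform 1%:M (v *m B) (v *m B).
  by rewrite vMk bformZl bformZr mulrA -addnn exprD.
have -> : M ^+ k.*2 = B^T *m B by rewrite Bs -addnn exprD mulmxE.
rewrite bform1E /mxtrace mulr_suml ler_sum // => j _.
have -> : (v *m B) 0 j = bform 1%:M v (col j B)^T.
  by rewrite bform1E mxE; apply: eq_bigr => i _; rewrite !mxE.
rewrite -expr2 mulrC; apply: le_trans (psd_cauchy _ _ psd1) _.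
rewrite ler_wpM2l ?bform1_ge0 // bform1E mxE.
by rewrite le_eqVlt; apply/orP; left; apply/eqP/eq_bigr => i _; rewrite !mxE.
Qed.

End QuadraticForms.

Lemma bform_mxtrace (R : realFieldType) (n : nat) (P : 'M[R]_n) (q : 'rV[R]_n) :
  bform P q q = \tr (P *m (q^T *m q)).
Proof. by rewrite mulmxA mxtrace_mulC mulmxA /mxtrace big_ord1. Qed.

(** * Traces of powers under a rank-one update *)

Section RankOneUpdate.
Variables (R : realFieldType) (n : nat) (M : 'M[R]_n) (q : 'rV[R]_n).
Variables (t mu L : R).
Hypotheses (M_psd : psd M) (M_mu : psd (M - mu%:M)) (t_ge0 : 0 <= t)
  (mu_gt0 : 0 < mu) (L_ge0 : 0 <= L) (q_le : bform 1%:M q q <= L).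
Let B := M + t *: (q^T *m q).

Lemma bform_rank1 (P P' : 'M[R]_n) (x y : 'rV[R]_n) :
  bform (P *m (q^T *m q) *m P') x y = bform P x q * bform P' q y.
Proof.
rewrite /bform.
have -> : x *m (P *m (q^T *m q) *m P') *m y^T =
    (x *m P *m q^T) *m (q *m P' *m y^T) by rewrite !mulmxA.
by rewrite mxE big_ord1.
Qed.

Lemma mixed_momentE k j :
  mixed_moment (moment M q) t k j = bform (B ^+ k *m M ^+ j) q q.
Proof.
elim: k j => [|k IHk] j /=; first by rewrite expr0 -idmxE mul1mx.
rewrite !IHk expr0 -idmxE mulmx1 [B ^+ _.+1]exprSr -mulmxE {4}/B.
rewrite mulmxDr mulmxDl bform_addM.
rewrite -scalemxAr -scalemxAl bform_scaleM bform_rank1 mulrA.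
by congr (_ + _); rewrite exprS -mulmxE mulmxA.
Qed.

(** Expanding the leading B gives an M, which joins M^j and is why j is general, and a rank-one
    term, which cyclicity of the trace turns into the mixed moment with index k. *)
Lemma mxtrace_telescope k j :
  \tr (M ^+ j *m B ^+ k) = \tr (M ^+ (k + j)) +
    t * \sum_(i < k) mixed_moment (moment M q) t i (k.-1 - i + j).
Proof.
elim: k j => [|k IHk] j.
  by rewrite expr0 -idmxE mulmx1 big_ord0 mulr0 addr0.
rewrite exprS -mulmxE {1}/B mulmxDl mulmxDr linearD /= mulmxA.
rewrite mulmxE -exprSr -mulmxE IHk addnS -addrA; congr (_ + _).
rewrite big_ord_recr /= subnn add0n mulrDr; congr (_ + _).
  congr (_ * _); apply: eq_bigr => i _; congr mixed_moment.
  by case: k i {IHk} => [[]//|k] i /=; rewrite subSn ?addSnnS // -ltnS.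
rewrite -scalemxAl -scalemxAr linearZ /= mixed_momentE; congr (_ * _).
rewrite bform_mxtrace [LHS]mxtrace_mulC -[_ *m _ *m M ^+ j]mulmxA.
exact: mxtrace_mulC.
Qed.

Lemma mxtrace_rank1 N : \tr (B ^+ N) - \tr (M ^+ N) =
    t * \sum_(i < N) mixed_moment (moment M q) t i (N.-1 - i).
Proof.
have := mxtrace_telescope N 0; rewrite expr0 -idmxE mul1mx addn0 => ->.
rewrite addrC addKr.
by under [in RHS]eq_bigr do rewrite -[(_ - _)%N]addn0.
Qed.

Let m_ge0 j : 0 <= moment M q j. Proof. exact: moment_ge0. Qed.
Let m_submul i j :
  moment M q i * moment M q j <= moment M q 0 * moment M q (i + j).
Proof. exact: moment_submul. Qed.
Let m0_le : moment M q 0 <= L. Proof. by rewrite /moment expr0 -idmxE. Qed.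
Let m_growth j : mu * moment M q j <= moment M q j.+1.
Proof. by apply: moment_growth => //; exact: ltW. Qed.

(** Bounding each mixed moment by a power of c times the moment of order N - 1 leaves a geometric
    sum. The factor L stays on the left because L may be 0. *)
Lemma mxtrace_rank1_upper N :
  L * (\tr (B ^+ N) - \tr (M ^+ N)) <=
  mu * ((1 + t * L / mu) ^+ N - 1) * moment M q N.-1.
Proof.
rewrite mxtrace_rank1; set c := 1 + t * L / mu.
have -> : mu * (c ^+ N - 1) = L * (t * \sum_(i < N) c ^+ i).
  have c1 : c - 1 = t * L / mu by rewrite /c; ring.
  by rewrite subrX1 c1; field; rewrite gt_eqF.
rewrite -!mulrA ler_wpM2l // ler_wpM2l // mulr_suml ler_sum // => i _.
apply: le_trans (mixed_moment_upper m_ge0 m_submul t_ge0 mu_gt0 L_ge0 m0_le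
  m_growth _ _) _.
by rewrite subnKC // -ltnS; case: N i => [[]|].
Qed.

(** The moment is that of B, not M: in the lower tail the rank-one term is subtracted, so B is the
    matrix before the draw and does not depend on the row drawn. *)
Lemma mxtrace_rank1_lower N : t * L <= mu ->
  mu * (1 - (1 - t * L / mu) ^+ N) * moment B q N.-1 <=
  L * (\tr (B ^+ N) - \tr (M ^+ N)).
Proof.
move=> tL_le; rewrite mxtrace_rank1.
set rho := 1 - t * L / mu.
have -> : mu * (1 - rho ^+ N) = L * (t * \sum_(i < N) rho ^+ i).
  have rho1 : rho - 1 = - (t * L / mu) by rewrite /rho; ring.
  by rewrite -opprB subrX1 rho1; field; rewrite gt_eqF.
rewrite -!mulrA ler_wpM2l // ler_wpM2l // mulr_suml.
(* Reversing the geometric sum matches the power of rho with the N - 1 - i factors M in the i-th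
   mixed moment. *)
rewrite (reindex_inj rev_ord_inj) ler_sum // => i _.
have -> : moment B q N.-1 = mixed_moment (moment M q) t N.-1 0.
  by rewrite mixed_momentE expr0 -idmxE mulmx1.
have iN : (i <= N.-1)%N by case: N i => [[]//|N'] i; rewrite -ltnS.
have := mixed_moment_lower m_ge0 m_submul t_ge0 mu_gt0 L_ge0 m0_le m_growth
  i (N.-1 - i) tL_le.
rewrite subnKC //=; congr (_ ^+ _ * _ <= _).
by case: N i iN => [[]|N] i //=; rewrite subSS.
Qed.

End RankOneUpdate.

(** * Sums over samples, one draw at a time *)

Section FfunSums.
Variables (R : realFieldType) (I : finType).

Definition ffun_cons l (i : I) (f : {ffun 'I_l -> I}) : {ffun 'I_l.+1 -> I} :=
  [ffun s => if unlift ord0 s is Some s' then f s' else i].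

Lemma ffun_cons0 l i (f : {ffun 'I_l -> I}) : ffun_cons i f ord0 = i.
Proof. by rewrite ffunE unlift_none. Qed.

Lemma ffun_consS l i (f : {ffun 'I_l -> I}) s :
  ffun_cons i f (lift ord0 s) = f s.
Proof. by rewrite ffunE liftK. Qed.

Lemma big_ffun_cons l (G : {ffun 'I_l.+1 -> I} -> R) :
  \sum_f G f = \sum_(f : {ffun 'I_l -> I}) \sum_i G (ffun_cons i f).
Proof.
rewrite pair_bigA /=.
rewrite (reindex (fun p : {ffun 'I_l -> I} * I => ffun_cons p.2 p.1)) //.
exists (fun f : {ffun 'I_l.+1 -> I} =>
  ([ffun s : 'I_l => f (lift ord0 s)], f ord0)) => [[f i] _|f _] /=.
  by rewrite ffun_cons0; congr pair; apply/ffunP => s; rewrite ffunE ffun_consS.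
apply/ffunP => s; rewrite ffunE.
by case: unliftP => [s' ->|->] //; rewrite ffunE.
Qed.

(** Iterated conditional expectation, written with sums. The one-step bound is asked only for k < l
    because the lower-tail potential is controlled only up to l draws. *)
Lemma sum_ffun_iter (V : zmodType) (X : I -> V) (Phi : V -> R) (c : R) l :
  0 <= c ->
  (forall k (f : {ffun 'I_k -> I}), (k < l)%N ->
     \sum_i Phi (\sum_s X (f s) + X i) <= c * Phi (\sum_s X (f s))) ->
  \sum_(f : {ffun 'I_l -> I}) Phi (\sum_s X (f s)) <= c ^+ l * Phi 0.
Proof.
move=> c0; elim: l => [|l IHl] H.
  rewrite (eq_bigr (fun=> Phi 0)) => [|f _]; last by rewrite big_ord0.
  by rewrite sumr_const card_ffun card_ord expr0 mul1r.
rewrite big_ffun_cons exprS -mulrA.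
apply: le_trans (ler_wpM2l c0 (IHl _)); last first.
  by move=> k f kl; apply: H; exact: ltnW.
rewrite mulr_sumr ler_sum // => f _.
apply: le_trans (H l f (ltnSn l)).
rewrite ler_sum // => i _; rewrite big_ord_recl ffun_cons0 addrC.
by under eq_bigr do rewrite ffun_consS.
Qed.

End FfunSums.

(** * Averaging the rank-one bounds over the rows of Q *)

Section Averaging.
Variables (R : realFieldType) (m n : nat) (Q : 'M[R]_(m, n)) (L : R).
Local Notation X i := ((row i Q)^T *m row i Q).

Lemma gram_rows : \sum_i X i = Q^T *m Q.
Proof.
apply/matrixP => a b; rewrite summxE mxE; apply: eq_bigr => i _.
by rewrite !mxE big_ord1 !mxE.
Qed.

Lemma psd_rank1 (q : 'rV[R]_n) : psd (q^T *m q).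
Proof.
split=> [|x]; first by rewrite trmx_mul trmxK.
have -> : q^T *m q = 1%:M *m (q^T *m q) *m 1%:M by rewrite mulmx1 mul1mx.
by rewrite bform_rank1 (bform_sym q x (trmx1 _ _)) -expr2 sqr_ge0.
Qed.

Lemma psd_scalar_sub_rank1 (q : 'rV[R]_n) a : bform 1%:M q q <= a ->
  psd (a%:M - q^T *m q).
Proof.
move=> qa; split=> [|x].
  by rewrite linearB /= tr_scalar_mx trmx_mul trmxK.
rewrite bform_addM bform_oppM subr_ge0.
have -> : q^T *m q = 1%:M *m (q^T *m q) *m 1%:M by rewrite mulmx1 mul1mx.
rewrite bform_rank1 (bform_sym q x (trmx1 _ _)) -expr2.
apply: le_trans (psd_cauchy _ _ (psd1 _ _)) _.
rewrite -[a%:M]scalemx1 bform_scaleM mulrC ler_wpM2r //.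
exact: bform1_ge0.
Qed.

Hypotheses (QtQ : Q^T *m Q = 1%:M)
  (L_gt0 : 0 < L) (row_le : forall i, bform 1%:M (row i Q) (row i Q) <= L).

Lemma sum_bform_rows (P : 'M[R]_n) :
  \sum_i bform P (row i Q) (row i Q) = \tr P.
Proof.
rewrite (eq_bigr (fun i => \tr (P *m X i))) => [|i _].
  2: exact: bform_mxtrace.
by rewrite -raddf_sum -mulmx_sumr gram_rows QtQ mulmx1.
Qed.

(** The moments of order N - 1 sum over the rows to the trace of M^(N-1), which M >= 1 bounds by the
    trace of M^N; this closes the recursion. *)
Lemma average_upper (M : 'M[R]_n) (t : R) (N : nat) :
  (0 < N)%N -> psd M -> psd (M - 1%:M) -> 0 <= t ->
  \sum_i \tr ((M + t *: X i) ^+ N) <=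
  (m%:R + ((1 + t * L) ^+ N - 1) / L) * \tr (M ^+ N).
Proof.
case: N => // N _; move=> M_psd M_ge1 t0; set g := _ - 1.
have g_ge0 : 0 <= g.
  by rewrite subr_ge0 exprn_ege1 // lerDl mulr_ge0 // ltW.
apply: (@le_trans _ _
  (\sum_i (\tr (M ^+ N.+1) + g / L * moment M (row i Q) N))).
  rewrite ler_sum // => i _; rewrite -lerBlDl mulrAC ler_pdivlMr // mulrC.
  have := mxtrace_rank1_upper M_psd M_ge1 t0 ltr01 (ltW L_gt0) (row_le i) N.+1.
  by rewrite divr1 mul1r.
rewrite big_split /= sumr_const card_ord -mulr_sumr sum_bform_rows.
rewrite [leRHS]mulrDl mulr_natl lerD2l ler_wpM2l ?divr_ge0 // ?(ltW L_gt0) //.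
exact: mxtrace_growth.
Qed.

(** The update runs from W - t X_i up to W, and mu bounds all these matrices from below. Since W <=
    1, the trace of W^(N-1) dominates that of W^N. *)
Lemma average_lower (W : 'M[R]_n) (t mu : R) (N : nat) :
  (0 < N)%N -> psd W -> psd (1%:M - W) -> 0 <= t -> 0 < mu -> t * L <= mu ->
  (forall i, psd (W - t *: X i - mu%:M)) ->
  \sum_i \tr ((W - t *: X i) ^+ N) <=
  (m%:R - mu * (1 - (1 - t * L / mu) ^+ N) / L) * \tr (W ^+ N).
Proof.
case: N => // N _; move=> W_psd W_le1 t0 mu0 tL_le M_ge; set g := mu * _.
have g_ge0 : 0 <= g.
  rewrite mulr_ge0 ?(ltW mu0) // subr_ge0 exprn_ile1 //.
    by rewrite subr_ge0 ler_pdivrMr // mul1r.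
  by rewrite gerBl divr_ge0 ?mulr_ge0 // ltW.
apply: (@le_trans _ _
  (\sum_i (\tr (W ^+ N.+1) - g / L * moment W (row i Q) N))).
  rewrite ler_sum // => i _; rewrite lerBrDl -lerBrDr mulrAC.
  rewrite ler_pdivrMr // [leRHS]mulrC.
  have M_psd : psd (W - t *: X i).
    rewrite -[_ - _](subrK mu%:M); apply: psdD => //.
    by rewrite -scalemx1; apply: psdZ (psd1 _ _); exact: ltW.
  have := mxtrace_rank1_lower M_psd (M_ge i) t0 mu0 (ltW L_gt0) (row_le i)
    N.+1 tL_le.
  by rewrite subrK.
rewrite sumrB sumr_const card_ord -mulr_sumr sum_bform_rows.
rewrite [leRHS]mulrBl mulr_natl lerD2l lerN2.
rewrite ler_wpM2l ?divr_ge0 // ?(ltW L_gt0) //.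
exact: mxtrace_decay.
Qed.

End Averaging.

(** * Scalar exponential estimates *)

Section Scalars.
Variable R : realType.

(* Both bounds multiply 1 + w <= exp w, for w = - z + z^2 and w = z + 2 z^2,
   by 1 + z or 1 - z. *)
Lemma expR_le1D (z : R) : 0 <= z -> expR (z - z ^+ 2) <= 1 + z.
Proof.
move=> z0; rewrite -[z - _]opprK expRN invf_ple ?posrE ?expR_gt0 ?ltr_wpDr //.
apply: le_trans (expR_ge1Dx _).
rewrite -[leLHS]mul1r ler_pdivrMr ?ltr_wpDr //.
have := exprn_ge0 3 z0; lra.
Qed.

Lemma expR_le1B (z : R) : 0 <= z <= 2^-1 -> expR (- (z + 2 * z ^+ 2)) <= 1 - z.
Proof.
move=> /andP[z0 z1]; have z_lt1 : 0 < 1 - z by lra.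
rewrite expRN invf_ple ?posrE ?expR_gt0 //.
apply: le_trans (expR_ge1Dx _).
rewrite -[leLHS]mul1r ler_pdivrMr //.
have : 0 <= z ^+ 2 * (1 - 2 * z) by rewrite mulr_ge0 ?sqr_ge0 //; lra.
lra.
Qed.

Lemma expR_exprn (x : R) k : expR x ^+ k = expR (k%:R * x).
Proof. by rewrite mulrC expRM_natr. Qed.

(** The limit K to infinity by contradiction: if y < x, then 1 - u <= exp (- u) gives x (1 - c / K)
    <= y, which fails once K exceeds x c / (x - y). *)
Lemma le_of_le_expR_inv (x y c : R) K0 : 0 <= y -> 0 <= c ->
  (forall K, (K0 < K)%N -> x <= y * expR (c / K%:R)) -> x <= y.
Proof.
move=> y0 c0 H; rewrite leNgt; apply/negP => yx.
have d_gt0 : 0 < x - y by rewrite subr_gt0.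
have x_gt0 : 0 < x by exact: le_lt_trans yx.
pose K := (K0 + Num.bound (x * c / (x - y))).+1.
have K_gt0 : 0 < K%:R :> R by rewrite ltr0n.
have : x * (1 - c / K%:R) <= y.
  apply: (@le_trans _ _ (x * expR (- (c / K%:R)))).
    by rewrite ler_wpM2l ?(ltW x_gt0) // expR_ge1Dx.
  by rewrite expRN ler_pdivrMr ?expR_gt0 // H // ltnS leq_addr.
apply/negP; rewrite -ltNge mulrBr mulr1 ltrBrDl -ltrBrDr mulrA ltr_pdivrMr //.
rewrite [ltRHS]mulrC -ltr_pdivrMr //.
have q_ge0 : 0 <= x * c / (x - y) by rewrite divr_ge0 ?mulr_ge0 // ltW.
apply: lt_le_trans (archi_boundP q_ge0) _.
by rewrite ler_nat leqW // leq_addl.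
Qed.

End Scalars.

(** * Tail bounds for a fixed power N *)

Section Tails.
Variables (R : realType) (m n l : nat) (Q : 'M[R]_(m, n)) (L : R).
Hypotheses (m_gt0 : (0 < m)%N) (QtQ : Q^T *m Q = 1%:M)
  (L_gt0 : 0 < L) (row_le : forall i, bform 1%:M (row i Q) (row i Q) <= L).
Local Notation X i := ((row i Q)^T *m row i Q).

Definition sample_gram k (f : {ffun 'I_k -> 'I_m}) : 'M[R]_n := \sum_s X (f s).

Lemma psd_scalar (a : R) : 0 <= a -> psd (a%:M : 'M[R]_n).
Proof. by move=> a0; rewrite -scalemx1; apply: psdZ a0 (psd1 _ _). Qed.

Lemma psd_sum (I : finType) (F : I -> 'M[R]_n) :
  (forall i, psd (F i)) -> psd (\sum_i F i).
Proof.
by move=> H; apply: (big_ind (@psd R n)) => //; [exact: psd0|exact: psdD].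
Qed.

Lemma sample_gram_psd k (f : {ffun 'I_k -> 'I_m}) : psd (sample_gram f).
Proof. by apply: psd_sum => s; exact: psd_rank1. Qed.

Lemma sample_gram_le k (f : {ffun 'I_k -> 'I_m}) :
  psd ((k%:R * L)%:M - sample_gram f).
Proof.
have -> : (k%:R * L)%:M - sample_gram f = \sum_(s < k) (L%:M - X (f s)).
  by rewrite mulr_natl raddfMn sumrB sumr_const card_ord.
by apply: psd_sum => s; exact: psd_scalar_sub_rank1.
Qed.

(** Markov's inequality by counting, where C bounds the mean of the potential. *)
Lemma prob_markov (E : {ffun 'I_l -> 'I_m} -> Prop) (Phi : 'M[R]_n -> R)
    (w C : R) :
  0 <= w -> (forall f : {ffun 'I_l -> 'I_m}, 0 <= Phi (sample_gram f)) ->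
  (forall f, E f -> w <= Phi (sample_gram f)) ->
  \sum_(f : {ffun 'I_l -> 'I_m}) Phi (sample_gram f) <= m%:R ^+ l * C ->
  @prob_unif R m l E * w <= C.
Proof.
move=> w0 Phi0 Ew sum_le; rewrite /prob_unif mulrAC natrX.
rewrite ler_pdivrMr ?exprn_gt0 ?ltr0n // [leRHS]mulrC.
apply: le_trans sum_le.
rewrite mulr_natl -sumr_const [leLHS](big_mkcond _ _) /= ler_sum // => f _.
by rewrite inE; case: asboolP => // /Ew.
Qed.

(** This event and the next are the tails of the extreme eigenvalues. An explicit eigenvector avoids
    ordering a spectrum and is what [mxtrace_exp_eigen] consumes. *)
Definition upper_event (a : R) (f : {ffun 'I_l -> 'I_m}) : Prop :=
  exists (v : 'rV[R]_n) (lam : R),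
    [/\ v != 0, v *m sample_gram f = lam *: v & a <= lam].

Definition lower_event (a : R) (f : {ffun 'I_l -> 'I_m}) : Prop :=
  exists (v : 'rV[R]_n) (lam : R),
    [/\ v != 0, v *m sample_gram f = lam *: v & lam <= a].

Lemma m_neq0 : (m%:R : R) != 0. Proof. by rewrite pnatr_eq0 -lt0n. Qed.

(** The potential starts at tr 1 = n, and each draw multiplies its mean by at most 1 + g / (m L) <=
    exp (g / (m L)). The power N = 2 K is even, as the eigenvalue bound on traces requires. *)
Lemma upper_moment_bound (a t : R) K : 0 <= a -> 0 <= t -> (0 < K)%N ->
  prob_unif R (upper_event a) * (1 + t * a) ^+ K.*2 <=
  n%:R * expR (l%:R / (m%:R * L) * (expR (K.*2%:R * (t * L)) - 1)).
Proof.
move=> a0 t0 K0; set N := K.*2; set g := expR _ - 1.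
have ta0 : 0 <= 1 + t * a by rewrite addr_ge0 ?mulr_ge0.
have M_psd k (f : {ffun 'I_k -> 'I_m}) : psd (1%:M + t *: sample_gram f).
  by apply: psdD (psd1 _ _) _; apply: psdZ t0 (sample_gram_psd f).
apply: (prob_markov (Phi := fun V => \tr ((1%:M + t *: V) ^+ N))).
- exact: exprn_ge0.
- by move=> f; exact: mxtrace_psd_exp_ge0.
- move=> f [v [lam [v0 vS a_le]]].
  apply: (@le_trans _ _ ((1 + t * lam) ^+ N)).
    rewrite lerXn2r ?nnegrE ?lerD2l ?ler_wpM2l //.
    by rewrite (le_trans ta0) // lerD2l ler_wpM2l.
  apply: mxtrace_exp_eigen v0 _; first by case: (M_psd _ f).
  by rewrite mulmxDr mulmx1 -scalemxAr vS scalerA scalerDl scale1r.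
apply: (@le_trans _ _ ((m%:R * expR (g / (m%:R * L))) ^+ l *
    \tr ((1%:M + t *: 0 : 'M[R]_n) ^+ N))).
  apply: (@sum_ffun_iter _ _ _ (fun i => X i)
    (fun V => \tr ((1%:M + t *: V) ^+ N))) => [|k f kl].
    by rewrite mulr_ge0 // ?ler0n // expR_ge0.
  under eq_bigr do rewrite scalerDr addrA.
  apply: le_trans (average_upper QtQ L_gt0 row_le _ (M_psd _ f) _ t0) _.
  - by rewrite double_gt0.
  - by rewrite addrC addKr; apply: psdZ t0 (sample_gram_psd f).
  rewrite ler_wpM2r ?mxtrace_psd_exp_ge0 //.
  apply: (@le_trans _ _ (m%:R * (1 + g / (m%:R * L)))); last first.
    by rewrite ler_wpM2l ?ler0n // expR_ge1Dx.
  have -> : m%:R * (1 + g / (m%:R * L)) = m%:R + g / L.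
    by field; rewrite m_neq0 gt_eqF.
  rewrite lerD2l ler_wpM2r ?invr_ge0 ?(ltW L_gt0) // lerD2r -expR_exprn.
  rewrite lerXn2r ?nnegrE ?expR_ge0 ?expR_ge1Dx //.
  by rewrite addr_ge0 // mulr_ge0 // ltW.
rewrite scaler0 addr0 idmxE expr1n -idmxE mxtrace1 exprMn expR_exprn.
rewrite le_eqVlt; apply/orP; left; apply/eqP.
by rewrite -[LHS]mulrA; congr (_ * _); rewrite mulrC; congr (_ * expR _); ring.
Qed.

Lemma lower_moment_bound (a t : R) K : (0 < K)%N -> 0 < t ->
  t * a <= 1 -> t * (l.+1%:R * L) <= 1 ->
  prob_unif R (lower_event a) * (1 - t * a) ^+ K.*2 <=
  n%:R * expR (- (l%:R / (m%:R * L) *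
    ((1 - t * (l%:R * L)) * (1 - expR (- (K.*2%:R * (t * L))))))).
Proof.
move=> K0 t_gt0 ta_le tl_le; set N := K.*2; set mu := 1 - t * (l%:R * L).
have t0 := ltW t_gt0; set g := mu * _.
have ta0 : 0 <= 1 - t * a by rewrite subr_ge0.
have tL_gt0 : 0 < t * L by rewrite mulr_gt0.
have tL_le : t * L <= mu.
  by move: tl_le; rewrite -addn1 natrD /mu; lra.
(* mu bounds 1 - t S from below for every sample of at most l rows; the l + 1 in the hypothesis
   leaves room for t L <= mu. *)
have mu_gt0 : 0 < mu by exact: lt_le_trans tL_le.
have gram_le k j (f : {ffun 'I_k -> 'I_m}) : (k <= j)%N ->
    psd ((j%:R * L)%:M - sample_gram f).
  move=> kj; rewrite -[(j%:R * L)%:M](subrK (k%:R * L)%:M) -addrA.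
  apply: psdD (sample_gram_le f).
  rewrite -raddfB /= -mulrBl -natrB //.
  by apply: psd_scalar; rewrite mulr_ge0 ?ler0n // ltW.
have M_ge k (f : {ffun 'I_k -> 'I_m}) : (k <= l)%N ->
    psd (1%:M - t *: sample_gram f - mu%:M).
  move=> kl; have -> : 1%:M - t *: sample_gram f - mu%:M =
      t *: ((l%:R * L)%:M - sample_gram f).
    rewrite addrAC -raddfB /= scalerBr; congr (_ - _).
    by rewrite scale_scalar_mx; congr (_%:M); rewrite /mu; ring.
  by apply: psdZ t0 _; exact: gram_le.
have M_psd k (f : {ffun 'I_k -> 'I_m}) : (k <= l)%N ->
    psd (1%:M - t *: sample_gram f).
  move=> kl; rewrite -[_ - _](subrK mu%:M).
  by apply: psdD (M_ge _ _ kl) (psd_scalar (ltW mu_gt0)).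
apply: (prob_markov (Phi := fun V => \tr ((1%:M - t *: V) ^+ N))).
- exact: exprn_ge0.
- by move=> f; apply: mxtrace_psd_exp_ge0; exact: M_psd.
- move=> f [v [lam [v0 vS a_le]]].
  have le_lam : 1 - t * a <= 1 - t * lam by rewrite lerB // ler_wpM2l.
  apply: (@le_trans _ _ ((1 - t * lam) ^+ N)).
    by rewrite lerXn2r ?nnegrE // (le_trans ta0).
  apply: mxtrace_exp_eigen v0 _; first by case: (M_psd _ f (leqnn _)).
  by rewrite mulmxBr mulmx1 -scalemxAr vS scalerA scalerBl scale1r.
apply: (@le_trans _ _ ((m%:R * expR (- g / (m%:R * L))) ^+ l *
    \tr ((1%:M - t *: 0 : 'M[R]_n) ^+ N))).
  apply: (@sum_ffun_iter _ _ _ (fun i => X i)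
    (fun V => \tr ((1%:M - t *: V) ^+ N))) => [|k f kl].
    by rewrite mulr_ge0 // ?ler0n // expR_ge0.
  under eq_bigr do rewrite scalerDr opprD addrA.
  apply: le_trans (average_lower QtQ L_gt0 row_le (N := N) _
    (M_psd _ f (ltnW kl)) _ t0 mu_gt0 tL_le _) _.
  - by rewrite double_gt0.
  - by rewrite opprB addrC subrK; apply: psdZ t0 (sample_gram_psd f).
  - move=> i.
    (* The updated matrix belongs to a sample of k + 1 <= l rows, so [M_ge] applies to it. *)
    have <- : 1%:M - t *: sample_gram (ffun_cons i f) =
        1%:M - t *: sample_gram f - t *: X i.
      rewrite -addrA -opprD -scalerDr; congr (_ - _ *: _).
      rewrite /sample_gram big_ord_recl ffun_cons0 [RHS]addrC.
      by under eq_bigr do rewrite ffun_consS.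
    exact: M_ge.
  rewrite ler_wpM2r ?mxtrace_psd_exp_ge0 //; first by apply: M_psd; exact: ltnW.
  apply: (@le_trans _ _ (m%:R * (1 + - g / (m%:R * L)))); last first.
    by rewrite ler_wpM2l ?ler0n // expR_ge1Dx.
  have -> : m%:R * (1 + - g / (m%:R * L)) = m%:R - g / L.
    by field; rewrite m_neq0 gt_eqF.
  rewrite lerD2l lerN2 ler_wpM2r ?invr_ge0 ?(ltW L_gt0) //.
  rewrite ler_wpM2l ?(ltW mu_gt0) //.
  rewrite lerD2l lerN2 -[Y in _ <= expR Y]mulrN -expR_exprn.
  rewrite lerXn2r ?nnegrE ?expR_ge0 //.
    by rewrite subr_ge0 ler_pdivrMr // mul1r.
  apply: le_trans (expR_ge1Dx _).
  rewrite lerD2l lerN2 ler_pdivlMr // ler_piMr ?(ltW tL_gt0) //.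
  by rewrite gerBl mulr_ge0 // mulr_ge0 ?ler0n // ltW.
rewrite scaler0 subr0 idmxE expr1n -idmxE mxtrace1 exprMn expR_exprn.
rewrite le_eqVlt; apply/orP; left; apply/eqP.
by rewrite -[LHS]mulrA; congr (_ * _); rewrite mulrC; congr (_ * expR _); ring.
Qed.

End Tails.

(** * Letting the power tend to infinity *)

Section Limits.
Variables (R : realType) (m n l : nat) (Q : 'M[R]_(m, n)) (L : R).
Hypotheses (m_gt0 : (0 < m)%N) (QtQ : Q^T *m Q = 1%:M)
  (L_gt0 : 0 < L) (row_le : forall i, bform 1%:M (row i Q) (row i Q) <= L).
Local Notation kap := (l%:R / (m%:R * L)).

Lemma upper_tail (delta : R) : 0 < delta ->
  prob_unif R (@upper_event R m n l Q ((1 + delta) * (l%:R / m%:R))) <=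
  n%:R * expR (kap * (delta - (1 + delta) * ln (1 + delta))).
Proof.
move=> delta0; set a := (1 + delta) * _; set P := prob_unif _ _.
have mN0 : m%:R != 0 :> R by rewrite pnatr_eq0 -lt0n.
have delta1 : 0 < 1 + delta by rewrite addr_gt0.
(* [th] is the optimal parameter of the exponential Chernoff bound; below t = th / N. *)
pose th := ln (1 + delta) / L; pose y := th * a.
have th0 : 0 <= th by rewrite divr_ge0 ?(ltW L_gt0) // ln_ge0 // lerDl ltW.
have a0 : 0 <= a by rewrite mulr_ge0 ?divr_ge0 ?ler0n // ltW.
have yE : y = kap * ((1 + delta) * ln (1 + delta)).
  by rewrite /y /th /a; field; rewrite mN0 gt_eqF.
(* With z = y / N and N = 2 K, the loss N z^2 in (1 + z)^N >= exp (N (z - z^2)) is (y^2 / 2) / K. *)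
apply: (@le_of_le_expR_inv _ _ _ (y ^+ 2 / 2) 0).
- by rewrite mulr_ge0 ?ler0n ?expR_ge0.
- by rewrite divr_ge0 // sqr_ge0.
move=> K K0; set N : R := K.*2%:R.
have NE : N = 2 * K%:R by rewrite /N -muln2 natrM mulrC.
have K0' : 0 < K%:R :> R by rewrite ltr0n.
have N0 : 0 < N by rewrite NE mulr_gt0.
pose t := th / N; have t0 : 0 <= t by rewrite divr_ge0 // ltW.
have := upper_moment_bound l m_gt0 QtQ L_gt0 row_le a0 t0 K0.
rewrite -/P -/N; have -> : N * (t * L) = ln (1 + delta).
  by rewrite /t /th; field; rewrite !gt_eqF.
rewrite lnK ?posrE // [1 + delta - 1]addrC addKr => H.
set z := t * a in H.
have z0 : 0 <= z by rewrite mulr_ge0.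
have pow_ge : expR (N * (z - z ^+ 2)) <= (1 + z) ^+ K.*2.
  rewrite -expR_exprn lerXn2r ?nnegrE ?expR_ge0 ?expR_le1D //.
  by rewrite addr_ge0.
have P0 : 0 <= P by rewrite /P /prob_unif divr_ge0 // ler0n.
have {}H := le_trans (ler_wpM2l P0 pow_ge) H.
rewrite -ler_pdivlMr ?expR_gt0 // -expRN in H.
apply: le_trans H _; rewrite -[leLHS]mulrA -[leRHS]mulrA -!expRD.
rewrite ler_wpM2l ?ler0n // ler_expR.
rewrite le_eqVlt; apply/orP; left; apply/eqP.
have -> : z = y / N by rewrite /z /t /y; ring.
have -> : kap * (delta - (1 + delta) * ln (1 + delta)) = kap * delta - y.
  by rewrite mulrBr yE.
rewrite NE; field.
by rewrite mN0 !gt_eqF.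
Qed.

Lemma lower_tail (eps : R) : 0 < eps < 1 ->
  prob_unif R (@lower_event R m n l Q ((1 - eps) * (l%:R / m%:R))) <=
  n%:R * expR (kap * (- eps - (1 - eps) * ln (1 - eps))).
Proof.
move=> /andP[eps0 eps1]; set a := (1 - eps) * _; set P := prob_unif _ _.
have mN0 : m%:R != 0 :> R by rewrite pnatr_eq0 -lt0n.
have eps1' : 0 < 1 - eps by rewrite subr_gt0.
pose th := - ln (1 - eps) / L; pose y := th * a.
have th_gt0 : 0 < th.
  by rewrite divr_gt0 // oppr_gt0 ln_lt0 // eps1' gtrBl.
have a0 : 0 <= a by rewrite mulr_ge0 ?divr_ge0 ?ler0n // ltW.
have y0 : 0 <= y by rewrite mulr_ge0 // ltW.
have kap0 : 0 <= kap.
  by rewrite divr_ge0 ?mulr_ge0 ?ler0n // ltW.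
have yE : y = - (kap * ((1 - eps) * ln (1 - eps))).
  by rewrite /y /th /a; field; rewrite mN0 gt_eqF.
pose w := th * (l.+1%:R * L).
have L0 := ltW L_gt0; have th0 := ltW th_gt0.
have wl0 j : 0 <= th * (j%:R * L) by apply: mulr_ge0 => //; exact: mulr_ge0.
have w0 : 0 <= w by exact: wl0.
(* The first summand is the loss from mu = 1 - t l L falling short of 1, the second that from
   replacing (1 - z)^N by an exponential. *)
pose c := (kap * eps * (th * (l%:R * L)) + 2 * y ^+ 2) / 2.
(* The threshold forces K >= w, hence t (l + 1) L <= 1, and K >= y, hence z <= 1/2. *)
apply: (@le_of_le_expR_inv _ _ _ c (Num.bound w + Num.bound y)).
- by rewrite mulr_ge0 ?ler0n ?expR_ge0.
- rewrite divr_ge0 // addr_ge0 //.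
    by apply: mulr_ge0 (wl0 l); exact: mulr_ge0 kap0 (ltW eps0).
  by apply: mulr_ge0 => //; exact: sqr_ge0.
move=> K K_gt; set N : R := K.*2%:R.
have NE : N = 2 * K%:R by rewrite /N -muln2 natrM mulrC.
have K0 : (0 < K)%N by exact: leq_ltn_trans K_gt.
have K0' : 0 < K%:R :> R by rewrite ltr0n.
have N0 : 0 < N by rewrite NE mulr_gt0.
have wK : w <= K%:R.
  apply: le_trans (ltW (archi_boundP w0)) _; rewrite ler_nat ltnW //.
  by apply: leq_ltn_trans K_gt; exact: leq_addr.
have yK : y <= K%:R.
  apply: le_trans (ltW (archi_boundP y0)) _; rewrite ler_nat ltnW //.
  by apply: leq_ltn_trans K_gt; exact: leq_addl.
pose t := th / N; have t_gt0 : 0 < t by rewrite divr_gt0.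
set z := t * a.
have zE : z = y / N by rewrite /z /t /y; ring.
have z0 : 0 <= z by rewrite mulr_ge0 // ltW.
have z_half : z <= 2^-1.
  by rewrite zE ler_pdivrMr // NE mulrA mulVf ?mul1r ?pnatr_eq0.
have z1 : z <= 1 by apply: le_trans z_half _; rewrite invf_le1 ?ltr0n ?ler1n.
have tl_le : t * (l.+1%:R * L) <= 1.
  by rewrite /t mulrAC ler_pdivrMr // mul1r -/w NE; lra.
have := lower_moment_bound m_gt0 QtQ L_gt0 row_le K0 t_gt0 z1 tl_le.
rewrite -/P -/N -/z; have -> : - (N * (t * L)) = ln (1 - eps).
  by rewrite /t /th; field; rewrite !gt_eqF.
rewrite lnK ?posrE // => H.
have pow_ge : expR (N * - (z + 2 * z ^+ 2)) <= (1 - z) ^+ K.*2.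
  rewrite -expR_exprn lerXn2r ?nnegrE ?expR_ge0 ?subr_ge0 //.
  by apply: expR_le1B; rewrite z0.
have P0 : 0 <= P by rewrite /P /prob_unif divr_ge0 // ler0n.
have {}H := le_trans (ler_wpM2l P0 pow_ge) H.
rewrite -ler_pdivlMr ?expR_gt0 // -expRN in H.
apply: le_trans H _; rewrite -[leLHS]mulrA -[leRHS]mulrA -!expRD.
rewrite ler_wpM2l ?ler0n // ler_expR.
rewrite le_eqVlt; apply/orP; left; apply/eqP.
have -> : kap * (- eps - (1 - eps) * ln (1 - eps)) = y - kap * eps.
  by rewrite mulrBr mulrN yE addrC.
rewrite zE /c /t NE; field.
by rewrite mN0 !gt_eqF.
Qed.

End Limits.

(** * Suprema and infima of finite sets are attained *)

Section FiniteExtrema.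
Local Open Scope classical_set_scope.
Variables (R : realType) (E : set R) (s : seq R).
Hypotheses (E_neq0 : E !=set0) (E_sub : forall x, E x -> x \in s).

Lemma sup_mem_seq : E (sup E).
Proof.
have [x0 Ex0] := E_neq0.
pose M := \big[Num.max/x0]_(y <- s | `[< E y >]) y.
have EM : E M.
  rewrite /M; elim/big_ind : _ => // [x y Ex Ey|y /asboolP//].
  by rewrite /Num.max; case: ifP.
have ubM : ubound E M.
  by move=> x Ex; apply: le_bigmax_seq (E_sub Ex) _ => //; exact/asboolP.
have -> : sup E = M; last by [].
apply/eqP; rewrite eq_le ge_sup //=.
by apply: ub_le_sup => //; exists M.
Qed.

End FiniteExtrema.

Lemma inf_mem_seq (R : realType) (E : set R) (s : seq R) :
  (E !=set0)%classic -> (forall x, E x -> x \in s) -> E (inf E).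
Proof.
move=> [x0 Ex0] E_sub; rewrite /inf.
have [||y Ey <-] := @sup_mem_seq _ [set - x | x in E]%classic (map -%R s).
- by exists (- x0), x0.
- by move=> _ [x Ex <-]; apply: map_f; exact: E_sub.
by rewrite opprK.
Qed.

(** Applied to the characteristic polynomial, this makes the spectrum finite, so that the extreme
    singular values come from actual eigenvalues. *)
Lemma poly_roots_seq (R : idomainType) (p : {poly R}) : p != 0 ->
  exists s : seq R, forall x, root p x -> x \in s.
Proof.
have [k] := ubnP (size p); elim: k p => // k IHk p sz_p p0.
have [[x px]|no_root] := pselect (exists x, root p x); last first.
  by exists [::] => x px; case: no_root; exists x.
have /factor_theorem [q pE] := px.
have q0 : q != 0 by apply: contraNneq p0 => q0; rewrite pE q0 mul0r.
have [|s sP] := IHk q _ q0.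
  by move: sz_p; rewrite pE size_Mmonic ?monicXsubC // size_XsubC addn2.
exists (x :: s) => y; rewrite pE rootM root_XsubC inE.
by case/orP => [/sP ->|->]; rewrite ?orbT.
Qed.

(** * From the condition number to the two tails *)

Section CondEvent.
Variables (R : realType) (m n l : nat) (A Q : 'M[R]_(m, n)) (Rf : 'M[R]_n).
Hypotheses (rankA : \rank A = n) (AE : A = Q *m Rf) (QtQ : Q^T *m Q = 1%:M).

Lemma sample_gramE (f : {ffun 'I_l -> 'I_m}) :
  sample_gram Q f = (sample_rows Q f)^T *m sample_rows Q f.
Proof.
rewrite -gram_rows; apply: eq_bigr => s _.
have -> // : row s (sample_rows Q f) = row (f s) Q.
by apply/rowP => j; rewrite !mxE.
Qed.

Lemma sample_rows_mulmx (f : {ffun 'I_l -> 'I_m}) :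
  sample_rows A f = sample_rows Q f *m Rf.
Proof.
by apply/matrixP => s j; rewrite AE !mxE; apply: eq_bigr => k _; rewrite !mxE.
Qed.

Lemma R_factor_unit : Rf \in unitmx.
Proof.
rewrite -row_free_unit -row_leq_rank -{1}rankA AE; exact: mxrankM_maxr.
Qed.

(** Since [Rf] is invertible, the sampled rows of Q lose rank too, and a kernel vector is an
    eigenvector for 0. The case of infinite condition number thus falls in the lower tail. *)
Lemma rank_deficient_lower_event (f : {ffun 'I_l -> 'I_m}) (a : R) :
  0 <= a -> (\rank (sample_rows A f) < n)%N -> lower_event Q a f.
Proof.
move=> a0; rewrite sample_rows_mulmx.
rewrite mxrankMfree ?row_free_unit ?R_factor_unit //.
rewrite -mxrank_tr ltnNge row_leq_rank -kermx_eq0 => /rowV0Pn[v v_ker v0].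
exists v, 0; split => //.
by rewrite sample_gramE mulmxA (sub_kermxP v_ker) mul0mx scale0r.
Qed.

(* The Gram matrix of X is W^T W with W = Rf R1^-1, and W W^T is the inverse
   of the sampled Gram matrix; W^T carries eigenvectors of the one to
   eigenvectors of the other, with inverse eigenvalue. *)
Lemma eigenvalue_precond (f : {ffun 'I_l -> 'I_m}) (Q1 : 'M[R]_(l, n))
    (R1 : 'M[R]_n) (a : R) :
  \rank (sample_rows A f) = n -> sample_rows A f = Q1 *m R1 ->
  Q1^T *m Q1 = 1%:M ->
  eigenvalue ((A *m invmx R1)^T *m (A *m invmx R1)) a ->
  0 < a /\ exists2 v : 'rV[R]_n, v != 0 & v *m sample_gram Q f = a^-1 *: v.
Proof.
move=> rankA1 A1E Q1tQ1.
have R1_unit : R1 \in unitmx.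
  by rewrite -row_free_unit -row_leq_rank -{1}rankA1 A1E; exact: mxrankM_maxr.
pose W := Rf *m invmx R1.
have W_unit : W \in unitmx by rewrite unitmx_mul R_factor_unit unitmx_inv.
have WT_unit : W^T \in unitmx by rewrite unitmx_tr.
have -> : A *m invmx R1 = Q *m W by rewrite AE mulmxA.
have -> : (Q *m W)^T *m (Q *m W) = W^T *m W.
  by rewrite trmx_mul mulmxA -[W^T *m Q^T *m Q]mulmxA QtQ mulmx1.
have gramE : W^T *m sample_gram Q f *m W = 1%:M.
  have -> : W^T *m sample_gram Q f *m W =
      (sample_rows A f *m invmx R1)^T *m (sample_rows A f *m invmx R1).
    by rewrite sample_gramE sample_rows_mulmx !trmx_mul !mulmxA.
  by rewrite A1E -mulmxA mulmxV // mulmx1.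
case/eigenvalueP => v vW v0; have W_neq0 : v *m W^T != 0.
  apply: contra_neq v0 => H; rewrite -[v](mulmxK WT_unit).
  by rewrite H mul0mx.
have a0 : 0 < a.
  have := bform1_gt0 W_neq0.
  have -> : bform 1%:M (v *m W^T) (v *m W^T) = a * bform 1%:M v v.
    by rewrite -bformZl -vW /bform !mulmx1 [(v *m W^T)^T]trmx_mul trmxK !mulmxA.
  by rewrite pmulr_lgt0 // bform1_gt0.
split=> //; exists (v *m W^T) => //.
apply: (can_inj (mulmxK W_unit)).
rewrite -scalemxAl -[v *m W^T *m W]mulmxA vW scalerA mulVf ?gt_eqF // scale1r.
by rewrite -[RHS]mulmx1 -gramE !mulmxA.
Qed.

(** With a and b the squared extreme singular values of X, both a^-1 and b^-1 are eigenvalues of the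
    sampled Gram matrix. If a^-1 exceeds (1 - eps) c, the ratio a / b pushes b^-1 to (1 + delta)
    c. *)
Lemma cond_event_tails (delta eps c : R) (f : {ffun 'I_l -> 'I_m}) :
  0 < delta -> 0 < eps < 1 -> 0 <= c ->
  cond_event A (Num.sqrt ((1 + delta) / (1 - eps))) f ->
  lower_event Q ((1 - eps) * c) f \/ upper_event Q ((1 + delta) * c) f.
Proof.
move=> d0 /andP[e0 e1] c0 ev.
have e1' : 0 < 1 - eps by rewrite subr_gt0.
have d1 : 0 < 1 + delta by rewrite addr_gt0.
have ec0 : 0 <= (1 - eps) * c by rewrite mulr_ge0 // ltW.
have [def|full] := ltnP (\rank (sample_rows A f)) n.
  by left; exact: rank_deficient_lower_event.
have rankA1 : \rank (sample_rows A f) = n.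
  by apply/eqP; rewrite eqn_leq full rank_leq_col.
case: ev => [|[Q1 [R1 [[A1E Q1tQ1 _ _]]]]]; first by rewrite ltnNge full.
rewrite /cond /sigma_max /sigma_min; set G := _^T *m _.
set E := (X in sup X).
have eigE a : eigenvalue G a ->
    0 < a /\ exists2 v : 'rV[R]_n, v != 0 & v *m sample_gram Q f = a^-1 *: v.
  exact: eigenvalue_precond rankA1 A1E Q1tQ1.
have [E0|/set0P E_neq0] := eqVneq E set0.
  (* For an empty spectrum [sup] defaults to 0, so the condition number is 0, below the positive
     threshold. *)
  rewrite E0 sup0 mul0r leNgt sqrtr_gt0 divr_gt0 //.
have [s sP] : exists s : seq R, forall x, E x -> x \in s.
  have [s sP] := poly_roots_seq (monic_neq0 (char_poly_monic G)).
  exists (map Num.sqrt s) => _ [a /= Ga <-]; apply: map_f.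
  by apply: sP; rewrite -eigenvalue_root_char.
have [a Ga <-] := sup_mem_seq E_neq0 sP.
have [b Gb <-] := inf_mem_seq E_neq0 sP.
have [a0 [u u0 uS]] := eigE a Ga; have [b0 [v v0 vS]] := eigE b Gb.
rewrite -sqrtrV ?(ltW b0) // -sqrtrM ?(ltW a0) //.
rewrite ler_sqrt ?divr_gt0 ?divr_ge0 ?(ltW a0) ?(ltW b0) //.
rewrite ler_pdivrMr // => ratio.
have [le_a|lt_a] := leP a^-1 ((1 - eps) * c); first by left; exists u, a^-1.
right; exists v, b^-1; split=> //.
rewrite -(ler_pM2r e1'); apply: (@le_trans _ _ ((1 + delta) * a^-1)).
  by rewrite -mulrA ler_pM2l // mulrC ltW.
rewrite -(ler_pM2r a0) mulfVK ?gt_eqF //.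
by rewrite [leRHS]mulrC mulrA.
Qed.

End CondEvent.

(** * Union bound and conclusion *)

Lemma prob_unif_union (R : realType) (m l : nat)
  (E F G : {ffun 'I_l -> 'I_m} -> Prop) : (forall f, E f -> F f \/ G f) ->
  prob_unif R E <= prob_unif R F + prob_unif R G.
Proof.
move=> EFG; rewrite /prob_unif -mulrDl ler_wpM2r ?invr_ge0 ?ler0n //.
rewrite -natrD ler_nat; apply: leq_trans (leq_card_setU _ _).
apply: subset_leq_card; apply/fintype.subsetP => f; rewrite !inE.
case: (asboolP (E f)) => // Ef _; apply/orP.
by have [Ff|Gf] := EFG f Ef; [left|right]; apply/asboolP.
Qed.

Lemma row_norm_le_theta (R : realType) (m n : nat) (Q : 'M[R]_(m, n)) i :
  bform 1%:M (row i Q) (row i Q) <= theta Q.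
Proof.
rewrite bform1E /theta; apply: le_trans (le_bigmax _ _ i).
rewrite le_eqVlt; apply/orP; left; apply/eqP/eq_bigr => j _.
by rewrite mxE expr2.
Qed.

(** The squared row norms add up to tr 1 = n > 0, so they cannot all be at most 0. *)
Lemma theta_gt0 (R : realType) (m n : nat) (Q : 'M[R]_(m, n)) :
  (0 < n)%N -> Q^T *m Q = 1%:M -> 0 < theta Q.
Proof.
move=> n0 QtQ; rewrite ltNge; apply/negP => th_le0.
have : \sum_i bform 1%:M (row i Q) (row i Q) <= 0.
  by apply: sumr_le0 => i _; exact: le_trans (row_norm_le_theta Q i) th_le0.
by rewrite (sum_bform_rows QtQ) mxtrace1 leNgt ltr0n n0.
Qed.

Lemma powR_expR_div (R : realType) (x a b : R) : 0 < a ->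
  (expR x / a `^ a) `^ b = expR (b * (x - a * ln a)).
Proof.
move=> a0; have -> : a `^ a = expR (a * ln a) by rewrite /powR gt_eqF.
by rewrite -expRN -expRD -expRM [b * _]mulrC.
Qed.

Theorem theorem3p3 (R : realType) (m n l : nat)
  (A : 'M[R]_(m, n)) (Q : 'M[R]_(m, n)) (Rf : 'M[R]_n) :
  (n <= m)%N -> \rank A = n ->
  A = Q *m Rf -> Q^T *m Q = 1%:M -> upper_tri Rf ->
  (n <= l)%N ->
  forall delta eps : R, 0 < delta -> 0 < eps < 1 ->
  @prob_unif R m l (fun f : {ffun 'I_l -> 'I_m} =>
     cond_event A (Num.sqrt ((1 + delta) / (1 - eps))) f)
  <= n%:R *
     ((expR (- eps) / (1 - eps) `^ (1 - eps)) `^ (l%:R / (m%:R * theta Q))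
      + (expR delta / (1 + delta) `^ (1 + delta)) `^ (l%:R / (m%:R * theta Q))).
Proof.
move=> le_nm rankA AE QtQ _ _ delta eps d0 e01; have /andP[e0 e1] := e01.
rewrite !powR_expR_div ?subr_gt0 ?addr_gt0 // mulrDr.
have c0 : 0 <= l%:R / m%:R :> R by rewrite divr_ge0 ?ler0n.
have tails f := @cond_event_tails R m n l A Q Rf rankA AE QtQ
  delta eps (l%:R / m%:R) f d0 e01 c0.
apply: le_trans (prob_unif_union R tails) _.
(* For n = 0 the tail bounds do not apply, as theta is 0; both events are empty for want of a
   nonzero vector. *)
have [n_gt0|] := ltnP 0 n; last first.
  rewrite leqn0 => /eqP n0; subst n.
  have no_event (P : {ffun 'I_l -> 'I_m} -> Prop) :
      (forall f, P f -> exists v : 'rV[R]_0, v != 0) -> prob_unif R P = 0.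
    move=> Pv; rewrite /prob_unif; have -> : [set f | `[< P f >]] = finset.set0.
      apply/setP => f; rewrite !inE; apply/asboolP => /Pv[v].
      by rewrite (thinmx0 v) eqxx.
    by rewrite cards0 mul0r.
  rewrite !no_event ?mul0r // => f [v [lam [v0 _ _]]]; by exists v.
have m_gt0 : (0 < m)%N by exact: leq_trans le_nm.
have row_le := row_norm_le_theta Q; have L_gt0 := theta_gt0 n_gt0 QtQ.
by apply: lerD; [exact: lower_tail|exact: upper_tail].
Qed.
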